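(* For every real $\epsilon>0$, $$\lim_{f\to\infty} \frac{\#\{S\mid S \text{ a numerical semigroup},\ f(S)=f,\ |g(S)-\frac{3f}{4}|<f^{\frac{1}{2}+\epsilon}\}}{N(f)}=1,$$ where $f$ ranges over the positive integers and $N(f)$ is the number of numerical semigroups with Frobenius number $f$.
   Context: A numerical semigroup is a subset $S\subseteq\mathbb{N}=\{0,1,2,\dots\}$ that contains $0$, is closed under addition, and has finite complement in $\mathbb{N}$. The genus $g(S)$ is the number of elements of $\mathbb{N}\setminus S$ (the gaps of $S$). The Frobenius number $f(S)$ is the largest element of $\mathbb{N}\setminus S$. For a given positive integer $f$ there are only finitely many numerical semigroups with Frobenius number $f$. *)

(* Defs.v *)
From mathcomp Require Import all_boot all_order all_algebra finmap.
From mathcomp Require Import all_classical all_reals all_analysis.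

Set Implicit Arguments.
Unset Strict Implicit.
Unset Printing Implicit Defensive.

Local Open Scope classical_set_scope.

Definition numerical_semigroup (S : set nat) : Prop :=
  [/\ S 0, (forall x y, S x -> S y -> S (x + y)) & finite_set (~` S)].

Definition genus (S : set nat) : nat := #|` fset_set (~` S)|%fset.

(* A relation rather than a function, since S = nat has no gaps and hence no
   largest gap. *)
Definition is_frobenius_number (S : set nat) (f : nat) : Prop :=
  (~` S) f /\ forall x, (~` S) x -> x <= f.

Definition semigroups_with_frobenius (f : nat) : set (set nat) :=
  [set S | numerical_semigroup S /\ is_frobenius_number S f].

(* [fset_set] sends infinite sets to [fset0]; this lemma ensures that the
   cardinals taken of subsets of [semigroups_with_frobenius f] are genuine. *)
Lemma finite_semigroups_with_frobenius (f : nat) :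
  finite_set (semigroups_with_frobenius f).
Proof.
pose h (B : {set 'I_f.+1}) : set nat :=
  [set n | f < n \/ exists2 i : 'I_f.+1, i \in B & n = i].
apply: (@sub_finite_set _ _ [set h B | B in [set: {set 'I_f.+1}]]); last first.
  exact: finite_image.
move=> S [_ [_ ubf]]; exists [set i : 'I_f.+1 | `[< S i >]]%SET => //.
apply/seteqP; split=> n /=.
  case=> [fn|[i]]; last by rewrite inE => /asboolP Si ->.
  by apply: contrapT => /ubf; rewrite leqNgt fn.
move=> Sn; case: (ltnP f n) => fn; [by left|right].
by exists (Ordinal (fn : n < f.+1)); rewrite // inE; apply/asboolP.
Qed.

Definition num_semigroups (f : nat) : nat :=
  #|` fset_set (semigroups_with_frobenius f)|%fset.

(* Main.v *)
(** A semigroup S with Frobenius number f is determined by its part in [0, f).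
Put h = floor((f-1)/2).  Every subset of the top h places extends to such a
semigroup, so N(f) >= 2^h, and it suffices that the exceptional semigroups are
o(2^h).

Multiplicities m < (f - D)/2.  Cut [0, f) into blocks consisting of chains of
residue classes mod m, each with its mirror image under x |-> f - x.  Closure
under adding m and the impossibility of x, f - x both lying in S leave few
traces of S on a block, and the number of semigroups is at most the product of
the numbers of traces.  Chains of length at least 4 give at most 15/16 of the
square root of the number of subsets of the block.  For f/4 < m < f/2 there are
chains of length 3, whose term below m is excluded, and on their blocks the
bound is exactly the square root; the gain then comes from a second element
m + p of S, which couples the block of u to that of u + p (or from the absence
of such elements).  In all cases at most C 2^h / (f - 2m)^2 semigroups have
multiplicity m, whose sum over m is at most C 2^h / D.

If the multiplicity is at least (f - D)/2, all but O(D) places below f/2 are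
forced, the genus is f + 1 minus the number of ones, and Chebyshev's inequality
for the top h bits finishes the proof. *)
Require Import Defs.
From mathcomp Require Import all_boot all_order all_algebra finmap.
From mathcomp Require Import all_classical all_reals all_analysis.
From mathcomp Require Import zify ring lra.
Import Order.TTheory GRing.Theory Num.Theory.
Import numFieldNormedType.Exports.

Set Implicit Arguments.
Unset Strict Implicit.
Unset Printing Implicit Defensive.

(** * Enumerating bit sequences and counting them by their traces on blocks *)

Fixpoint bits (n : nat) : seq bitseq :=
  if n is n'.+1 then
    [seq true :: w | w <- bits n'] ++ [seq false :: w | w <- bits n']
  else [:: [::]].

Lemma mem_bits n w : (w \in bits n) = (size w == n).
Proof.
elim: n w => [|n IHn] w /=; first by rewrite inE; case: w.
rewrite mem_cat; case: w => [|b w] /=.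
  by apply/negbTE; rewrite negb_or; apply/andP; split; apply/mapP => -[].
rewrite eqSS -IHn; case: b.
  rewrite mem_map; last by move=> ? ? [].
  by rewrite (_ : _ \in map _ _ = false) ?orbF //; apply/mapP => -[].
rewrite [X in _ || X]mem_map; last by move=> ? ? [].
by rewrite (_ : _ \in map _ _ = false) //; apply/mapP => -[].
Qed.

Lemma size_bits n : size (bits n) = 2 ^ n.
Proof. by elim: n => //= n IHn; rewrite size_cat !size_map IHn expnS; lia. Qed.

Lemma uniq_bits n : uniq (bits n).
Proof.
elim: n => //= n IHn.
rewrite cat_uniq !map_inj_uniq ?IHn; try by move=> ? ? [].
rewrite andbT; apply/hasPn => _ /mapP[w _ ->].
by apply/mapP => -[].
Qed.

(* A bitseq of size f stands for the subset {x < f | nth false A x} of [0, f). *)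
Definition trace (A : bitseq) (b : seq nat) : bitseq := [seq nth false A x | x <- b].

Fixpoint words (T : Type) (s : seq T) (n : nat) : seq (seq T) :=
  if n is n'.+1 then [seq x :: w | x <- s, w <- words s n'] else [:: [::]].

Lemma size_words (T : Type) (s : seq T) n : size (words s n) = size s ^ n.
Proof. by elim: n => //= n IHn; rewrite size_allpairs IHn expnS. Qed.

Lemma mem_words (T : eqType) (s : seq T) w :
  all (mem s) w -> w \in words s (size w).
Proof.
elim: w => //= x w IHw /andP[xs /IHw ws].
by apply/allpairsP; exists (x, w).
Qed.

(* The blocks gblk i, for i in gidx, each with glen places, on which only the
   traces satisfying gok occur. *)
Record group := Group {
  gidx : seq nat;
  gblk : nat -> seq nat;
  glen : nat;
  gok : pred bitseq }.

Definition gvalid (A : bitseq) (g : group) : Prop :=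
  forall i, i \in gidx g ->
    size (gblk g i) = glen g /\ gok g (trace A (gblk g i)).

Definition gagree (A B : bitseq) (g : group) : Prop :=
  forall i, i \in gidx g -> forall x, x \in gblk g i -> nth false A x = nth false B x.

Fixpoint allg (Q : group -> Prop) (gs : seq group) : Prop :=
  if gs is g :: gs' then Q g /\ allg Q gs' else True.

Definition gcount (g : group) : nat :=
  count (gok g) (bits (glen g)) ^ size (gidx g).

Definition gprod (gs : seq group) : nat := \prod_(g <- gs) gcount g.

(** By the second hypothesis the list of all traces determines [A] within [P]; by the first it is
    one of [gprod gs] lists of allowed traces. The blocks need not be disjoint. *)
Lemma count_le_gprod (f : nat) (P : pred bitseq) (gs : seq group) :
  (forall A, size A = f -> P A -> allg (gvalid A) gs) ->
  (forall A B, size A = f -> size B = f -> P A -> P B -> allg (gagree A B) gs ->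
     forall x, x < f -> nth false A x = nth false B x) ->
  count P (bits f) <= gprod gs.
Proof.
move=> val sep.
pose gwords g := words (seq.filter (gok g) (bits (glen g))) (size (gidx g)).
pose allowed :=
  foldr (fun g acc => [seq w :: s | w <- gwords g, s <- acc]) [:: [::]].
pose gcode A g := [seq trace A (gblk g i) | i <- gidx g].
pose code gs A := [seq gcode A g | g <- gs].
have -> : gprod gs = size (allowed gs).
  rewrite /gprod; elim: (gs) => [|g l IHl]; first by rewrite big_nil.
  by rewrite big_cons /= size_allpairs -IHl size_words size_filter.
rewrite -size_filter -(size_map (code gs)).
apply: uniq_leq_size.
  rewrite map_inj_in_uniq ?filter_uniq ?uniq_bits // => A B.
  rewrite !mem_filter !mem_bits => /andP[PA /eqP sA] /andP[PB /eqP sB] eAB.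
  apply: (@eq_from_nth _ false); rewrite ?sA ?sB // => x.
  apply: sep => //.
  move: eAB; rewrite /code; elim: (gs) => //= g l IHl [eg el]; split; last exact: IHl.
  move=> i ig x' xi.
  have := eq_in_map (fun i => trace A (gblk g i)) (fun i => trace B (gblk g i)) (gidx g).
  move=> [_ /(_ eg)] /(_ i ig) et.
  have [_] := eq_in_map (nth false A) (nth false B) (gblk g i).
  by move=> /(_ et); apply.
move=> _ /mapP[A + ->]; rewrite mem_filter mem_bits => /andP[PA /eqP sA].
have := val A sA PA; rewrite /code; elim: (gs) => //= g l IHl [vg vl].
apply/allpairsP; exists (gcode A g, [seq gcode A g | g <- l]); split=> //=; last exact: IHl.
rewrite /gwords -(size_map (fun i => trace A (gblk g i)) (gidx g)).
apply: mem_words; apply/allP => _ /mapP[i ig ->].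
have [sz ok] := vg i ig.
by rewrite inE mem_filter ok mem_bits size_map sz eqxx.
Qed.

Lemma count_union (f : nat) (P Q : pred bitseq) (r : seq nat)
    (Qs : nat -> pred bitseq) :
  (forall A, P A -> Q A || has (Qs^~ A) r) ->
  count P (bits f) <= count (predI P Q) (bits f)
     + \sum_(v <- r) count (predI P (Qs v)) (bits f).
Proof.
move=> cov; elim: (bits f) => [|A s IHs] /=.
  by rewrite add0n; apply: leq0n.
have -> : \sum_(v <- r) (P A && Qs v A + count (predI P (Qs v)) s)
   = \sum_(v <- r) (P A && Qs v A) + \sum_(v <- r) count (predI P (Qs v)) s.
  by rewrite big_split.
suff : P A <= P A && Q A + \sum_(v <- r) (P A && Qs v A) by lia.
case PA: (P A) => //=; case/orP: (cov A PA) => [->|/hasP[v vr qv]] //.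
by rewrite (big_rem v) //= qv; lia.
Qed.

Lemma leq_expn m n e : m <= n -> m ^ e <= n ^ e.
Proof. by case: e => // e; rewrite leq_exp2r. Qed.

(** * Blocks of chains with three terms, the one below [m] excluded *)

(** The clause [x + y != f] expresses that [f] is a gap: [f] itself is not a place of [A]. *)
Definition closed_upto (f : nat) (A : bitseq) : Prop :=
  forall x y, nth false A x -> nth false A y ->
    x + y != f /\ (x + y < f -> nth false A (x + y)).

(* In pat4 and pat8, places 0-3 are those of blk4; since
   f = 2m + 2lo + d, places 0 and 2 are mirror images of each other. *)
Definition pat4 : pred bitseq := fun w =>
  [&& nth false w 0 ==> nth false w 1, nth false w 2 ==> nth false w 3
    & ~~ (nth false w 0 && nth false w 2)].

Definition pat8 : pred bitseq := fun w =>
  [&& pat4 w, pat4 (drop 4 w), nth false w 0 ==> nth false w 5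
    & nth false w 6 ==> nth false w 3].

Definition blk4 (m lo d u : nat) : seq nat :=
  [:: m + lo + u; 2 * m + lo + u; m + lo + (d - u); 2 * m + lo + (d - u)].

Lemma trace_blk4 f m lo d A u :
  f = 2 * m + 2 * lo + d -> closed_upto f A -> nth false A m ->
  0 < u < d -> pat4 (trace A (blk4 m lo d u)).
Proof.
move=> ef clA Am /andP[u0 ud]; rewrite /pat4 /=; apply/and3P; split.
- apply/implyP => /(clA _ _ Am) [_].
  by rewrite (_ : m + _ = 2 * m + lo + u); [apply; lia | lia].
- apply/implyP => /(clA _ _ Am) [_].
  by rewrite (_ : m + _ = 2 * m + lo + (d - u)); [apply; lia | lia].
- by apply/andP => -[a b]; have [/eqP] := clA _ _ a b; lia.
Qed.

(** Adding [m + t] takes place 0 of the block of [u] to place 1 of the block of [u + t], and place 2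
    of the latter to place 3 of the former. These are the implications from 0 to 5 and from 6 to
    3. *)
Lemma trace_blk8 f m lo d A t u :
  f = 2 * m + 2 * lo + d -> closed_upto f A -> nth false A m ->
  nth false A (m + t) -> 0 < u -> u + t < d ->
  pat8 (trace A (blk4 m lo d u ++ blk4 m lo d (u + t))).
Proof.
move=> ef clA Am At u0 utd; rewrite /pat8; apply/and4P; split.
- by apply: (@trace_blk4 f m lo d A (u)) => //; lia.
- by apply: (@trace_blk4 f m lo d A (u + t)) => //; lia.
- apply/implyP => /= /(clA _ _ At) [_].
  by rewrite (_ : _ + _ = 2 * m + lo + (u + t)); [apply; lia | lia].
- apply/implyP => /= /(clA _ _ At) [_].
  by rewrite (_ : _ + _ = 2 * m + lo + (d - u)); [apply; lia | lia].
Qed.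

Definition agree_interval (m lo d : nat) (A B : bitseq) : Prop :=
  forall u, 0 < u < d ->
    nth false A (m + lo + u) = nth false B (m + lo + u) /\
    nth false A (2 * m + lo + u) = nth false B (2 * m + lo + u).

Lemma agree_interval_half m lo d A B :
  (forall u, 0 < u -> u <= d./2 ->
     forall x, x \in blk4 m lo d u -> nth false A x = nth false B x) ->
  agree_interval m lo d A B.
Proof.
move=> H u /andP[u0 ud].
case: (leqP u d./2) => hu.
  by split; apply: (H u u0 hu); rewrite !inE eqxx ?orbT.
have h1 : 0 < d - u by lia.
have h2 : d - u <= d./2 by lia.
have e : d - (d - u) = u by lia.
by split; apply: (H (d - u) h1 h2); rewrite !inE e eqxx ?orbT.
Qed.

Definition single_blocks (m lo d a n : nat) : group :=
  Group (iota a n) (blk4 m lo d) 4 pat4.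

(** Together with the two excluded places below [m] a block has six places, so 8 is exactly the
    square root of the number of its subsets: a single block yields no gain. *)
Lemma count_pat4 : count pat4 (bits 4) = 8.
Proof. by vm_compute. Qed.

(* P is a family of semigroups containing m, determined by its traces on the
   places m + lo + u, 2m + lo + u (0 < u < d) and on the blocks of gs. *)
Definition interval_system (f m lo d : nat) (P : pred bitseq) (gs : seq group) : Prop :=
  [/\ forall A, size A = f -> P A -> closed_upto f A /\ nth false A m,
      forall A, size A = f -> P A -> allg (gvalid A) gs &
      forall A B, size A = f -> size B = f -> P A -> P B ->
        agree_interval m lo d A B -> allg (gagree A B) gs ->
        forall x, x < f -> nth false A x = nth false B x].

Lemma gprod_cons g gs : gprod (g :: gs) = gcount g * gprod gs.
Proof. by rewrite /gprod big_cons. Qed.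

Lemma gcount_iota a n blk len ok :
  gcount (Group (iota a n) blk len ok) = count ok (bits len) ^ n.
Proof. by rewrite /gcount /= size_iota. Qed.

Lemma gvalid_single f m lo d A a n :
  f = 2 * m + 2 * lo + d -> closed_upto f A -> nth false A m ->
  0 < a -> a + n <= d./2.+1 -> 0 < d -> gvalid A (single_blocks m lo d a n).
Proof.
move=> ef clA Am a0 an d0 u; rewrite mem_iota => ur; split=> //.
by apply: (trace_blk4 ef clA Am); lia.
Qed.

Lemma count_interval f m lo d P gs :
  f = 2 * m + 2 * lo + d -> 0 < d -> interval_system f m lo d P gs ->
  count P (bits f) <= 8 ^ d./2 * gprod gs.
Proof.
move=> ef d0 [clP vgs sep].
rewrite -count_pat4 -(gcount_iota 1 _ (blk4 m lo d)) -gprod_cons.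
apply: count_le_gprod.
  move=> A sA PA; have [clA Am] := clP A sA PA; split; last exact: vgs.
  by apply: (gvalid_single ef clA Am) => //; lia.
move=> A B sA sB PA PB [ag agr]; apply: sep => //.
by apply: agree_interval_half => u u0 ud; apply: ag; rewrite mem_iota; lia.
Qed.

Lemma count_interval_empty f m lo d k P gs :
  f = 2 * m + 2 * lo + d -> 0 < d -> interval_system f m lo d P gs -> 2 * k <= d./2 ->
  count (predI P (fun A => ~~ has (fun v => nth false A (m + lo + v)) (iota k.+1 k)))
    (bits f) <= 8 ^ (d./2 - k) * 6 ^ k * gprod gs.
Proof.
move=> ef d0 [clP vgs sep] kd.
pose pat6 : pred bitseq := fun w => ~~ nth false w 0 && pat4 w.
have c6 : count pat6 (bits 4) = 6 by vm_compute.
apply: (@leq_trans (gprod [:: single_blocks m lo d 1 k,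
    Group (iota k.+1 k) (blk4 m lo d) 4 pat6,
    single_blocks m lo d (2 * k).+1 (d./2 - 2 * k) & gs])); last first.
  rewrite !gprod_cons !gcount_iota c6 count_pat4.
  rewrite (_ : d./2 - k = k + (d./2 - 2 * k)) ?expnD; last lia.
  by rewrite leq_eqVlt; apply/orP; left; apply/eqP; ring.
apply: count_le_gprod.
  move=> A sA /andP[PA /hasPn nA]; have [clA Am] := clP A sA PA.
  split; [|split; [|split]]; last exact: vgs.
  - by apply: (gvalid_single ef clA Am) => //; lia.
  - move=> u ur; split=> //; rewrite /pat6; apply/andP; split; first exact: nA.
    by apply: (trace_blk4 ef clA Am); move: ur; rewrite mem_iota; lia.
  - by apply: (gvalid_single ef clA Am) => //; lia.
move=> A B sA sB /andP[PA _] /andP[PB _] [ag1 [ag2 [ag3 agr]]]; apply: sep => //.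
apply: agree_interval_half => u u0 ud.
case: (leqP u k) => uk; first by apply: ag1; rewrite mem_iota; lia.
case: (leqP u (2 * k)) => u2k; first by apply: ag2; rewrite mem_iota; lia.
by apply: ag3; rewrite mem_iota; lia.
Qed.

Lemma count_interval_shift f m lo d k v P gs :
  f = 2 * m + 2 * lo + d -> 0 < d -> interval_system f m lo d P gs ->
  k < v -> v + lo + k <= d./2 ->
  count (predI P (fun A => nth false A (m + lo + v))) (bits f)
    <= 8 ^ (d./2 - 2 * k) * 56 ^ k * gprod gs.
Proof.
move=> ef d0 [clP vgs sep] kv vd.
(* Of the 64 pairs of traces 53 survive; the bound 56 = 7 * 8 lets the powers of 8 cancel later. *)
have c8 : count pat8 (bits 8) <= 56 by vm_compute.
(* The given element is [m + t], so the block of [u] is coupled with that of [u + t] for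
   [1 <= u <= k]. Since [k < v] and [v + lo + k <= d./2], the two ranges are disjoint and lie in the
   half that is needed. *)
pose t := lo + v.
apply: (@leq_trans (gprod [:: Group (iota 1 k)
      (fun u => blk4 m lo d u ++ blk4 m lo d (u + t)) 8 pat8,
    single_blocks m lo d k.+1 (t - k),
    single_blocks m lo d (t + k).+1 (d./2 - (t + k)) & gs])); last first.
  rewrite !gprod_cons !gcount_iota count_pat4.
  rewrite (_ : d./2 - 2 * k = (t - k) + (d./2 - (t + k))) ?expnD; last lia.
  rewrite [leqRHS](_ : _ = 56 ^ k * (8 ^ (t - k) *
     (8 ^ (d./2 - (t + k)) * gprod gs))); last by ring.
  by rewrite leq_mul2r; apply/orP; right; exact: leq_expn.
apply: count_le_gprod.
  move=> A sA /andP[PA Av]; have [clA Am] := clP A sA PA.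
  split; [|split; [|split]]; last exact: vgs.
  - move=> u; rewrite mem_iota => ur; split=> //.
    by apply: (trace_blk8 ef clA Am); rewrite /t; [rewrite addnA| lia| lia].
  - by apply: (gvalid_single ef clA Am) => //; lia.
  - by apply: (gvalid_single ef clA Am) => //; lia.
move=> A B sA sB /andP[PA _] /andP[PB _] [ag1 [ag2 [ag3 agr]]]; apply: sep => //.
apply: agree_interval_half => u u0 ud.
case: (leqP u k) => uk.
  move=> x xu; apply: (ag1 u); first by rewrite mem_iota; lia.
  by rewrite mem_cat xu.
case: (leqP u t) => ut; first by apply: ag2; rewrite mem_iota; lia.
case: (leqP u (t + k)) => utk; last by apply: ag3; rewrite mem_iota; lia.
move=> x xu; apply: (ag1 (u - t)); first by rewrite mem_iota; lia.
by rewrite mem_cat (_ : u - t + t = u) ?xu ?orbT //; lia.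
Qed.

(* A fixed element m + lo + v of the semigroup with k < v <= 2k links every
   block to another one and lowers the number of joint traces from 64 to 56;
   if there is no such element, k blocks have 6 traces instead of 8. *)
Lemma count_interval_gain f m lo d P gs :
  f = 2 * m + 2 * lo + d -> 0 < d -> interval_system f m lo d P gs -> lo <= d %/ 8 ->
  count P (bits f) * 8 ^ (d %/ 8)
    <= (d %/ 8).+1 * 7 ^ (d %/ 8) * 8 ^ d./2 * gprod gs.
Proof.
move=> ef d0 ok lod; set k := d %/ 8.
(* With [lo <= k] and [v <= 2 * k] this gives [v + lo + k <= d./2], as the coupling requires. *)
have kd : 4 * k <= d./2 by rewrite /k; lia.
have h6 := @count_interval_empty f m lo d k P gs ef d0 ok ltac:(lia).
have := @count_union f P
  (fun A => ~~ has (fun v => nth false A (m + lo + v)) (iota k.+1 k))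
  (iota k.+1 k) (fun v A => nth false A (m + lo + v))
  (fun A _ => orNb _).
set S := \sum_(_ <- _) _ => hu.
have hS : S <= k * (8 ^ (d./2 - 2 * k) * 56 ^ k * gprod gs).
  rewrite -{1}(size_iota k.+1 k) -sum1_size big_distrl /= /S.
  rewrite big_seq [leqRHS]big_seq.
  apply: leq_sum => v; rewrite mem_iota mul1n => vr.
  by apply: (count_interval_shift ef d0 ok); lia.
apply: (@leq_trans ((8 ^ (d./2 - k) * 6 ^ k * gprod gs
   + k * (8 ^ (d./2 - 2 * k) * 56 ^ k * gprod gs)) * 8 ^ k)).
  by rewrite leq_mul2r; apply/orP; right; lia.
have -> : 56 ^ k = 7 ^ k * 8 ^ k by rewrite -expnMn.
have -> : 8 ^ d./2 = 8 ^ (d./2 - 2 * k) * 8 ^ k * 8 ^ k.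
  by rewrite -!expnD; congr (_ ^ _); lia.
have -> : 8 ^ (d./2 - k) = 8 ^ (d./2 - 2 * k) * 8 ^ k.
  by rewrite -!expnD; congr (_ ^ _); lia.
have l67 : 6 ^ k <= 7 ^ k by exact: leq_expn.
set X := 8 ^ k; set Y := 8 ^ _; set Z := gprod gs.
rewrite [leqLHS](_ : _ = Y * X * X * Z * (6 ^ k + k * 7 ^ k)); last by ring.
rewrite [leqRHS](_ : _ = Y * X * X * Z * (k.+1 * 7 ^ k)); last by ring.
by rewrite leq_mul2l; apply/orP; right; rewrite mulSn leq_add2r.
Qed.

(** * Blocks of two mirror chains with at least four terms *)

Definition chain (p l i : nat) : seq nat := [seq i + t * p | t <- iota 0 l].

Definition blk_chain (p l i j : nat) : seq nat := chain p l i ++ chain p l j.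

(** Both chains are closed upwards, and term [t] of one is the mirror image of term [l.-1 - t] of
    the other. *)
Definition pat_chain (l : nat) : pred bitseq := fun w =>
  all (fun t => [&& nth false w t ==> nth false w t.+1
                  & nth false w (l + t) ==> nth false w (l + t).+1]) (iota 0 l.-1)
  && all (fun t => ~~ (nth false w t && nth false w (l + (l.-1 - t)))) (iota 0 l).

(** An allowed trace has [a] final ones on the first chain and [b] on the second with [a + b <= l],
    which makes (l+1)(l+2)/2 traces. The case [l = 4] is tight: 15 against 16. *)
Lemma count_pat_chain l : 3 < l < 9 ->
  16 * count (pat_chain l) (bits l.*2) <= 15 * 2 ^ l.
Proof.
by case: l => [|[|[|[|[|[|[|[|[|l]]]]]]]]] // _; vm_compute.
Qed.

Lemma size_blk_chain p l i j : size (blk_chain p l i j) = l.*2.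
Proof. by rewrite size_cat !size_map !size_iota addnn. Qed.

Lemma nth_trace A b k : k < size b -> nth false (trace A b) k = nth false A (nth 0 b k).
Proof. exact: nth_map. Qed.

Lemma nth_blk_chain_l p l i j t : t < l -> nth 0 (blk_chain p l i j) t = i + t * p.
Proof.
move=> tl; rewrite nth_cat size_map size_iota tl.
by rewrite (nth_map 0) ?size_iota // nth_iota.
Qed.

Lemma nth_blk_chain_r p l i j t : t < l -> nth 0 (blk_chain p l i j) (l + t) = j + t * p.
Proof.
move=> tl; rewrite nth_cat size_map size_iota ltnNge leq_addr /= addKn.
by rewrite (nth_map 0) ?size_iota // nth_iota.
Qed.

Lemma trace_blk_chain f p l A i j :
  closed_upto f A -> nth false A p -> 0 < i -> 0 < j -> 0 < l ->
  i + j + l.-1 * p = f -> pat_chain l (trace A (blk_chain p l i j)).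
Proof.
move=> clA Ap i0 j0 l0 ef.
have bnd t : t < l.-1 -> t.+1 * p <= l.-1 * p by move=> tl; rewrite leq_mul2r tl orbT.
apply/andP; split; apply/allP => t; rewrite mem_iota; simpl in t => tl.
  have b := bnd t ltac:(lia).
  rewrite -addnS !nth_trace; [|by rewrite size_blk_chain; lia..].
  rewrite 2?nth_blk_chain_l ?nth_blk_chain_r; [|lia..].
  apply/andP; split; apply/implyP => /(clA _ _ Ap)[_]; rewrite mulSn in b *.
    by rewrite addnCA; apply; lia.
  by rewrite addnCA; apply; lia.
rewrite !nth_trace; [|by rewrite size_blk_chain; lia..].
rewrite nth_blk_chain_l ?nth_blk_chain_r; [|lia..].
apply/negP => /andP[a b]; have [/eqP[]] := clA _ _ a b.
by rewrite -ef (_ : l.-1 = t + (l.-1 - t)) ?mulnDl; lia.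
Qed.

Lemma mem_chain_blk p l i j t : t < l ->
  (i + t * p \in blk_chain p l i j) && (j + t * p \in blk_chain p l i j).
Proof.
by move=> tl; rewrite !mem_cat; apply/andP; split; apply/orP; [left|right];
  apply/mapP; exists t; rewrite ?mem_iota.
Qed.

(* The partner of the class of a + u is the class of a + (s - u); the blocks
   u <= s / 2 therefore meet all classes. *)
Definition chain_group (p l a s : nat) : group :=
  Group (iota 1 s./2) (fun u => blk_chain p l (a + u) (a + (s - u))) l.*2 (pat_chain l).

Lemma gvalid_chain f p l a s A :
  closed_upto f A -> nth false A p -> 0 < l -> 0 < s ->
  2 * a + s + l.-1 * p = f -> gvalid A (chain_group p l a s).
Proof.
move=> clA Ap l0 s0 ef u; rewrite mem_iota => us; split.
  exact: size_blk_chain.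
by apply: (trace_blk_chain clA Ap) => //; lia.
Qed.

Lemma gagree_chain p l a s A B u t :
  gagree A B (chain_group p l a s) -> 0 < u < s -> t < l ->
  nth false A (a + u + t * p) = nth false B (a + u + t * p).
Proof.
move=> ag us tl; case: (leqP u s./2) => hu.
  apply: (ag u); first by rewrite mem_iota; lia.
  by case/andP: (mem_chain_blk p (a + u) (a + (s - u)) tl).
apply: (ag (s - u)); first by rewrite mem_iota; lia.
rewrite [X in a + X + _](_ : u = s - (s - u)); last lia.
by case/andP: (mem_chain_blk p (a + (s - u)) (a + (s - (s - u))) tl).
Qed.

Lemma closed_mul f A p t : closed_upto f A -> nth false A 0 -> nth false A p ->
  t * p < f -> nth false A (t * p).
Proof.
move=> clA A0 Ap; elim: t => [|t IHt] //= tp.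
rewrite mulSn in tp *.
by have [_] := clA p (t * p) Ap (IHt ltac:(lia)); apply.
Qed.

Lemma closed_sub f A x : closed_upto f A -> x < f ->
  nth false A (f - x) -> nth false A x = false.
Proof.
move=> clA xf Afx; apply/negP => Ax; have [/eqP] := clA _ _ Ax Afx; lia.
Qed.

(** With [f = q * p + r], the classes strictly between 0 and [r] have [q.+1] terms and those
    strictly between [r] and [p] have [q]. The classes of 0 and [r] are determined: multiples of [p]
    belong to the semigroup, and their mirror images do not. *)
Lemma count_chains f p (P : pred bitseq) :
  0 < p -> 3 < f %/ p < 8 ->
  (forall A, size A = f -> P A ->
     [/\ closed_upto f A, nth false A 0 & nth false A p]) ->
  count P (bits f) * 16 ^ ((f %% p)./2 + (p - f %% p)./2)
    <= 15 ^ ((f %% p)./2 + (p - f %% p)./2) * 2 ^ f./2.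
Proof.
move=> p0; have := divn_eq f p; have := ltn_pmod f p0.
set q := f %/ p; set r := f %% p => rp ef q48 hP.
have hc : count P (bits f) <= gprod [:: chain_group p q.+1 0 r; chain_group p q r (p - r)].
  apply: count_le_gprod.
    move=> A sA PA; have [clA A0 Ap] := hP A sA PA; split; [|split] => //.
      (* For [r = 0] this group has no blocks. *)
      case: (posnP r) => r0; first by move=> u; rewrite r0.
      by apply: (@gvalid_chain f) => //; rewrite /=; lia.
    by apply: (@gvalid_chain f) => //; lia.
  move=> A B sA sB PA PB [ag1 [ag2 _]] x xf.
  have [clA A0 Ap] := hP A sA PA; have [clB B0 Bp] := hP B sB PB.
  have := divn_eq x p; have := ltn_pmod x p0.
  set t := x %/ p; set i := x %% p => ip ex.
  have tq : t <= q.
    rewrite leqNgt; apply/negP => qt.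
    have : q.+1 * p <= t * p by rewrite leq_mul2r qt orbT.
    by rewrite mulSn; lia.
  case: (posnP i) => i0.
    by rewrite ex i0 addn0 !(closed_mul (f := f)) //; lia.
  have ex' : x = i + t * p by lia.
  case: (ltngtP i r) => ir.
  - by rewrite ex' -[i]add0n; apply: (gagree_chain ag1); lia.
  - have tq' : t < q.
      by rewrite ltn_neqAle tq andbT; apply/eqP => tq'; move: ex xf; rewrite tq'; lia.
    by rewrite ex' -(subnKC (ltnW ir)); apply: (gagree_chain ag2); lia.
  - have fx : f - x = (q - t) * p by rewrite mulnBl; lia.
    have lt : (q - t) * p < f by rewrite -fx; lia.
    by rewrite (closed_sub clA xf) ?(closed_sub clB xf) // fx (closed_mul (f := f)).
have h1 := @count_pat_chain q.+1 ltac:(lia).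
have h2 := @count_pat_chain q ltac:(lia).
rewrite !gprod_cons !gcount_iota /gprod big_nil muln1 in hc.
set c1 := count _ _ in h1 hc; set c2 := count (pat_chain q) _ in h2 hc.
set k1 := r./2 in hc *; set k2 := (p - r)./2 in hc *.
apply: (@leq_trans (c1 ^ k1 * c2 ^ k2 * 16 ^ (k1 + k2))).
  by rewrite leq_mul2r hc orbT.
rewrite !expnD.
rewrite [leqLHS](_ : _ = (16 * c1) ^ k1 * (16 * c2) ^ k2); last by rewrite !expnMn; ring.
apply: (@leq_trans ((15 * 2 ^ q.+1) ^ k1 * (15 * 2 ^ q) ^ k2)).
  by apply: leq_mul; apply: leq_expn.
rewrite !expnMn -!expnM.
rewrite [leqLHS](_ : _ = 15 ^ k1 * 15 ^ k2 * 2 ^ (q.+1 * k1 + q * k2));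
  last by rewrite expnD; ring.
rewrite leq_mul2l leq_exp2l //; apply/orP; right.
(* The exponent of 2 is at most half of [q.+1 * r + q * (p - r) = f]. *)
have l1 : q.+1 * (k1 * 2) <= q.+1 * r by rewrite leq_mul2l /k1; lia.
have l2 : q * (k2 * 2) <= q * (p - r) by rewrite leq_mul2l /k2; lia.
have qrp : q * r <= q * p by rewrite leq_mul2l ltnW ?orbT.
by rewrite mulnBr in l2; rewrite mulSn in l1; lia.
Qed.

(** * Semigroups of a given multiplicity *)

Definition has_mult (f m : nat) (P : pred bitseq) : Prop :=
  forall A, size A = f -> P A ->
    [/\ closed_upto f A, nth false A 0, nth false A m &
        forall x, 0 < x < m -> nth false A x = false].

(** Brings the different gains to one form: a saving of [(a/b)^l] with [a/b <= 15/16] and [l >= k]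
    is at least a saving of [(15/16)^k]. *)
Lemma gain_weaken n c y a b k l :
  16 * a <= 15 * b -> 0 < b -> k <= l -> n * b ^ l <= c * a ^ l * y ->
  n * 16 ^ k <= c * 15 ^ k * y.
Proof.
move=> ab b0 kl; have ab' : a <= b by lia.
rewrite -(subnKC kl) !expnD => h.
have h' : n * b ^ k <= c * a ^ k * y.
  rewrite -(leq_pmul2r (_ : 0 < b ^ (l - k))) ?expn_gt0 ?b0 //.
  rewrite -mulnA; apply: (leq_trans h).
  rewrite [leqLHS](_ : _ = c * a ^ k * y * a ^ (l - k)); last by ring.
  by rewrite leq_mul2l leq_expn ?orbT.
rewrite -(leq_pmul2r (_ : 0 < b ^ k)) ?expn_gt0 ?b0 //.
rewrite [leqLHS](_ : _ = n * b ^ k * 16 ^ k); last by ring.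
rewrite [leqRHS](_ : _ = c * y * (15 * b) ^ k); last by rewrite expnMn; ring.
apply: (@leq_trans (c * a ^ k * y * 16 ^ k)); first by rewrite leq_mul2r h' orbT.
rewrite [leqLHS](_ : _ = c * y * (16 * a) ^ k); last by rewrite expnMn; ring.
by rewrite leq_mul2l leq_expn ?orbT.
Qed.

(** The classes strictly between 0 and [d] have three terms, the lowest excluded by the
    multiplicity, so [lo = 0]. The places strictly between [m + d] and [2 * m] stay free, and
    [m + d] is excluded as the mirror image of [m]. *)
Lemma count_mult_large f m d P :
  f = 2 * m + d -> 0 < d <= m -> has_mult f m P ->
  count P (bits f) * 8 ^ (d %/ 8)
    <= (d %/ 8).+1 * 7 ^ (d %/ 8) * 2 ^ (f.-1./2).+1.
Proof.
move=> ef /andP[d0 dm] hP.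
pose rest := Group (iota d.+1 (m.-1 - d)) (fun i => [:: m + i]) 1 predT.
have ok : interval_system f m 0 d P [:: rest].
  split=> [A sA PA|A sA PA|A B sA sB PA PB agI [agr _] x xf].
  - by have [] := hP A sA PA.
  - by split.
  have [clA A0 Am Alow] := hP A sA PA; have [clB B0 Bm Blow] := hP B sB PB.
  case: (posnP x) => x0; first by rewrite x0 A0 B0.
  case: (ltngtP x m) => xm; last by rewrite xm Am Bm.
    by rewrite Alow ?Blow //; lia.
  case: (ltngtP x (m + d)) => xmd.
  - have [] := agI (x - m); first by lia.
    by rewrite (_ : m + 0 + (x - m) = x) //; lia.
  - case: (ltngtP x (2 * m)) => x2m.
    + apply: (agr (x - m)); first by rewrite mem_iota; lia.
      by rewrite inE; apply/eqP; lia.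
    + have [] := agI (x - 2 * m); first by lia.
      by rewrite (_ : 2 * m + 0 + _ = x) //; lia.
    + by rewrite x2m !(closed_mul (f := f)) //; lia.
  - have fx : f - x = m by lia.
    by rewrite (closed_sub clA xf) ?(closed_sub clB xf) // fx.
have := @count_interval_gain f m 0 d P _ ltac:(lia) d0 ok isT.
rewrite gprod_cons gcount_iota /gprod big_nil muln1 /= => h.
apply: (leq_trans h); rewrite -mulnA leq_mul2l; apply/orP; right.
rewrite (_ : 8 = 2 ^ 3) // -expnM -expnD leq_exp2l //; lia.
Qed.

(** The classes strictly between 0 and [r] have four terms, and those strictly between [r] and [m]
    have three, the lowest excluded; hence [lo = r]. The classes of 0 and [r] are determined by
    [m]. *)
Lemma interval_system_mid f m r P :
  f = 3 * m + r -> 0 < r < m -> has_mult f m P ->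
  interval_system f m r (m - r) P [:: chain_group m 4 0 r].
Proof.
move=> ef /andP[r0 rm] hP.
split=> [A sA PA|A sA PA|A B sA sB PA PB agI [agr _] x xf].
- by have [] := hP A sA PA.
- have [clA A0 Am Alow] := hP A sA PA; split=> //.
  by apply: (@gvalid_chain f) => //=; lia.
have [clA A0 Am Alow] := hP A sA PA; have [clB B0 Bm Blow] := hP B sB PB.
have m0 : 0 < m by lia.
have := divn_eq x m; have := ltn_pmod x m0.
set t := x %/ m; set i := x %% m => im ex.
have t4 : t < 4.
  rewrite ltnNge; apply/negP => t4.
  have : 4 * m <= t * m by rewrite leq_mul2r t4 orbT.
  by lia.
case: (posnP i) => i0.
  by rewrite ex i0 addn0 !(closed_mul (f := f)) //; lia.
case: (ltngtP i r) => ir.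
- by rewrite ex addnC -[i]add0n; apply: (gagree_chain agr); lia.
- case: t t4 ex => [|[|[|[|t]]]] // _ ex; last by lia.
  + by rewrite Alow ?Blow //; lia.
  + have [] := agI (x - m - r); first by lia.
    by rewrite (_ : m + r + _ = x) //; lia.
  + have [|_] := agI (x - 2 * m - r); first by lia.
    by rewrite (_ : 2 * m + r + _ = x) //; lia.
- have fx : f - x = (3 - t) * m by rewrite mulnBl; lia.
  have lt : (3 - t) * m < f by rewrite -fx; lia.
  by rewrite (closed_sub clA xf) ?(closed_sub clB xf) // fx (closed_mul (f := f)).
Qed.

Lemma gcount_chain4 m a r :
  gcount (chain_group m 4 a r) = 15 ^ r./2.
Proof. by rewrite gcount_iota (_ : count _ _ = 15) //; vm_compute. Qed.

(** For small [r] there may be too few chains with four terms, so their blocks are bounded by 16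
    without gain and the saving comes from the long interval. *)
Lemma count_mult_mid_near f m r P :
  f = 3 * m + r -> 0 < r < m -> has_mult f m P -> r <= (m - r) %/ 8 ->
  count P (bits f) * 8 ^ ((m - r) %/ 8)
    <= ((m - r) %/ 8).+1 * 7 ^ ((m - r) %/ 8) * 2 ^ (f.-1./2).+1.
Proof.
move=> ef rm hP hr; have ok := interval_system_mid ef rm hP.
have := @count_interval_gain f m r (m - r) P _ ltac:(lia) ltac:(lia) ok hr.
rewrite gprod_cons gcount_chain4 /gprod big_nil muln1 => h.
apply: (leq_trans h); rewrite -mulnA leq_mul2l; apply/orP; right.
apply: (@leq_trans (8 ^ (m - r)./2 * 16 ^ r./2)).
  by rewrite leq_mul2l leq_expn ?orbT.
rewrite (_ : 8 = 2 ^ 3) // (_ : 16 = 2 ^ 4) // -!expnM -expnD leq_exp2l //; lia.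
Qed.

(** Here the blocks with four-term chains alone give the saving, 15 traces instead of 16 on each; it
    suffices when [r] is large. *)
Lemma count_mult_mid_far f m r P :
  f = 3 * m + r -> 0 < r < m -> has_mult f m P ->
  count P (bits f) * 16 ^ r./2 <= 15 ^ r./2 * 2 ^ (f.-1./2).+1.
Proof.
move=> ef rm hP; have ok := interval_system_mid ef rm hP.
have := @count_interval f m r (m - r) P _ ltac:(lia) ltac:(lia) ok.
rewrite gprod_cons gcount_chain4 /gprod big_nil muln1 => h.
apply: (@leq_trans (8 ^ (m - r)./2 * 15 ^ r./2 * 16 ^ r./2)).
  by rewrite leq_mul2r h orbT.
rewrite [leqLHS](_ : _ = 15 ^ r./2 * (8 ^ (m - r)./2 * 16 ^ r./2)); last by ring.
rewrite leq_mul2l; apply/orP; right.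
rewrite (_ : 8 = 2 ^ 3) // (_ : 16 = 2 ^ 4) // -!expnM -expnD leq_exp2l //; lia.
Qed.

Lemma count_mult_small f m P :
  0 < m -> 4 * m <= f -> has_mult f m P ->
  exists2 l, f %/ 20 <= l.+1 &
  count P (bits f) * 16 ^ l <= 15 ^ l * 2 ^ f./2.
Proof.
move=> m0 mf hP; pose p := f %/ 4 %/ m * m.
have mf4 : m <= f %/ 4 by rewrite leq_divRL //; lia.
have q0 : 0 < f %/ 4 %/ m by rewrite divn_gt0.
have pm : m <= p by rewrite /p leq_pmull.
have e4 := divn_eq (f %/ 4) m; have r4 := ltn_pmod (f %/ 4) m0.
rewrite -/p in e4.
have p0 : 0 < p by lia.
(* p is a multiple of m in (f/8, f/4], so the classes mod p have 4 to 8 terms. *)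
exists ((f %% p)./2 + (p - f %% p)./2).
  have := ltn_pmod f p0; lia.
apply: count_chains => //.
  apply/andP; split; first by rewrite leq_divRL //; lia.
  by rewrite ltn_divLR //; lia.
move=> A sA PA; have [clA A0 Am Alow] := hP A sA PA; split=> //.
by apply: (closed_mul clA) => //; rewrite -/p; lia.
Qed.

(** There are four ranges: [4 * m <= f], [f <= 3 * m], and in between [r = f - 3 * m] small or large
    against [m - r]. The exponent is chosen below the gain of each. *)
Lemma count_mult f m P :
  0 < m -> 2 * m < f -> has_mult f m P ->
  count P (bits f) * 16 ^ ((f - 2 * m) %/ 40).-1
    <= (f - 2 * m).+1 * 15 ^ ((f - 2 * m) %/ 40).-1 * 2 ^ (f.-1./2).+1.
Proof.
move=> m0 mf hP; set d := f - 2 * m.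
case: (leqP (4 * m) f) => m4.
  have [l hl] := count_mult_small m0 m4 hP.
  rewrite -[15 ^ l]mul1n => h.
  have := gain_weaken (k := (d %/ 40).-1) (a := 15) (b := 16) isT isT _ h.
  move=> /(_ ltac:(lia)) h'; apply: (leq_trans h').
  apply: leq_mul; first by apply: leq_mul.
  by rewrite leq_exp2l //; lia.
case: (leqP f (3 * m)) => m3.
  have h := @count_mult_large f m d P ltac:(lia) ltac:(lia) hP.
  have := gain_weaken (k := (d %/ 40).-1) (a := 7) (b := 8) isT isT _ h.
  move=> /(_ ltac:(lia)) h'; apply: (leq_trans h').
  by apply: leq_mul => //; apply: leq_mul => //; lia.
pose r := f - 3 * m.
have ef : f = 3 * m + r by lia.
case: (leqP r ((m - r) %/ 8)) => hr.
  have h := @count_mult_mid_near f m r P ef ltac:(lia) hP hr.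
  have := gain_weaken (k := (d %/ 40).-1) (a := 7) (b := 8) isT isT _ h.
  move=> /(_ ltac:(lia)) h'; apply: (leq_trans h').
  by apply: leq_mul => //; apply: leq_mul => //; lia.
have := @count_mult_mid_far f m r P ef ltac:(lia) hP.
rewrite -[15 ^ r./2]mul1n => h.
have := gain_weaken (k := (d %/ 40).-1) (a := 15) (b := 16) isT isT _ h.
move=> /(_ ltac:(lia)) h'; apply: (leq_trans h').
by apply: leq_mul => //; apply: leq_mul.
Qed.

(** As long as the base of the cube is at most 52 both factors compare directly; from there on the
    cube grows by less than 16/15 per step. *)
Lemma cube_le_geom k : k.+1 ^ 3 * 15 ^ k <= 52 ^ 3 * 16 ^ k.
Proof.
elim: k => [|k IHk]; first by apply: leq_mul; apply: leq_expn.
case: (leqP k 50) => k50.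
  by apply: leq_mul; apply: leq_expn; lia.
have h1 : 15 * k.+2 ^ 3 <= 16 * k.+1 ^ 3 by rewrite !expnS expn0; nia.
rewrite (expnS 15) (expnS 16).
move: (k.+2 ^ 3) (k.+1 ^ 3) (15 ^ k) (16 ^ k) (52 ^ 3) h1 IHk => a b x y c h1 h2.
rewrite [leqLHS](_ : _ = 15 * a * x); last by ring.
apply: (@leq_trans (16 * (b * x))); first by rewrite mulnA leq_mul2r h1 orbT.
by rewrite [leqRHS]mulnCA leq_mul2l h2 orbT.
Qed.

Lemma poly_le_geom : exists C, forall d,
  d.+1 * d ^ 2 * 15 ^ (d %/ 40).-1 <= C * 16 ^ (d %/ 40).-1.
Proof.
have lin d : d.+1 <= 120 * (d %/ 40).-1.+1 by lia.
move: (52 ^ 3) 120 cube_le_geom lin => c a hc lin.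
exists (a ^ 3 * c) => d; move: (lin d) (hc (d %/ 40).-1).
move: (_ %/ _).-1 => k dk hk.
have h2 : d.+1 * d ^ 2 <= (a * k.+1) ^ 3.
  by rewrite [leqRHS]expnS; apply: leq_mul => //; apply: leq_expn; exact: ltnW.
apply: (@leq_trans ((a * k.+1) ^ 3 * 15 ^ k)); first by rewrite leq_mul2r h2 orbT.
by rewrite expnMn -[leqLHS]mulnA -[leqRHS]mulnA leq_mul2l hk orbT.
Qed.

(** The geometric gain absorbs the factor [(f - 2 * m).+1] and still leaves an inverse square, which
    is summable over [m]. *)
Lemma count_mult_poly : exists C, forall f m P,
  0 < m -> 2 * m < f -> has_mult f m P ->
  count P (bits f) * (f - 2 * m) ^ 2 <= C * 2 ^ f.-1./2.
Proof.
have [C hC] := poly_le_geom; exists (2 * C) => f m P m0 mf hP.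
have := count_mult m0 mf hP; have := hC (f - 2 * m).
move: (f - 2 * m) => d; rewrite (expnS 2); move: (_ %/ _).-1 (count _ _) (2 ^ _) => k n y h2 h.
rewrite -(leq_pmul2r (_ : 0 < 16 ^ k)) ?expn_gt0 //.
rewrite [leqLHS](_ : _ = n * 16 ^ k * d ^ 2); last by ring.
apply: (@leq_trans (d.+1 * 15 ^ k * (2 * y) * d ^ 2)); first by rewrite leq_mul2r h orbT.
rewrite [leqLHS](_ : _ = d.+1 * d ^ 2 * 15 ^ k * (2 * y)); last by ring.
rewrite [leqRHS](_ : _ = C * 16 ^ k * (2 * y)); last by ring.
by rewrite leq_mul2r h2 orbT.
Qed.

(** * Chebyshev's inequality and large multiplicities *)

Local Open Scope ring_scope.

(** This is the variance of a sum of [n] independent signs; the induction rests on (x+1)^2 + (x-1)^2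
    = 2x^2 + 2. *)
Lemma sum_bits_sqr_dev (R : comPzRingType) n :
  \sum_(w <- bits n) ((2 * count id w)%N%:R - n%:R : R) ^+ 2 = (n * 2 ^ n)%N%:R.
Proof.
elim: n => [|n IHn] /=; first by rewrite big_seq1 /= subrr expr0n.
rewrite big_cat !big_map /= -big_split /=.
transitivity (\sum_(w <- bits n)
   (2 * ((2 * count id w)%N%:R - n%:R : R) ^+ 2 + 2)).
  by apply: eq_bigr => w _; rewrite mulnDr natrD -natr1; ring.
rewrite big_split /= -big_distrr /= IHn big_const_seq count_predT size_bits.
rewrite iter_addr_0 -mulr_natr !natrM expnS natrM -natr1.
by ring.
Qed.

Lemma chebyshev_bits (R : realFieldType) n (t : R) (P : pred bitseq) : 0 <= t ->
  (forall w, size w = n -> P w -> t <= `|(count id w)%:R - n%:R / 2|) ->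
  (count P (bits n))%:R * (4 * t ^+ 2) <= (n * 2 ^ n)%N%:R.
Proof.
move=> t0 hP; rewrite -(sum_bits_sqr_dev R n) -sum1_count natr_sum big_distrl /=.
rewrite [leRHS](bigID P) /= -[leLHS]addr0 big_seq_cond [X in _ <= X + _]big_seq_cond.
apply: lerD; last by apply: sumr_ge0 => w _; exact: sqr_ge0.
apply: ler_sum => w; rewrite mem_bits => /andP[/eqP sw Pw].
have h := hP w sw Pw.
have : t ^+ 2 <= ((count id w)%:R - n%:R / 2) ^+ 2.
  by rewrite -[leRHS]real_normK ?num_real // ler_sqr // ?nnegrE.
by rewrite natrM; nra.
Qed.

Lemma trace_iota A a n : (a + n = size A)%N -> trace A (iota a n) = drop a A.
Proof.
move=> e; apply: (@eq_from_nth _ false); first by rewrite size_map size_iota size_drop -e addKn.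
move=> i; rewrite size_map size_iota => i_n.
by rewrite nth_trace ?size_iota // nth_iota // nth_drop.
Qed.

(** Places below [b] are forced, those from [b] up to the top [f.-1./2] are left free, and on the
    top places only [Q] is kept. *)
Lemma count_low_free f b (P Q : pred bitseq) : (0 < b)%N -> (b <= f - f.-1./2)%N ->
  (forall A, size A = f -> P A ->
     [/\ nth false A 0, forall x, (0 < x < b)%N -> nth false A x = false &
         Q (drop (f - f.-1./2) A)]) ->
  (count P (bits f) <= 2 ^ (f - f.-1./2 - b) * count Q (bits f.-1./2))%N.
Proof.
set h := f.-1./2 => b0 bf hP.
apply: (@leq_trans (gprod [:: Group (iota b (f - h - b)) (fun i => [:: i]) 1 predT;
    Group [:: 0%N] (fun _ => iota (f - h) h) h Q])); last first.
  by rewrite !gprod_cons gcount_iota /gprod big_nil muln1 /gcount /= expn1.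
apply: count_le_gprod.
  move=> A sA PA; have [A0 Alow QA] := hP A sA PA.
  split; last split=> //; first by move=> i _; split.
  move=> i _; rewrite size_iota /= trace_iota; last by rewrite sA; lia.
  by split.
move=> A B sA sB PA PB [ag1 [ag2 _]] x xf.
have [A0 Alow _] := hP A sA PA; have [B0 Blow _] := hP B sB PB.
case: (posnP x) => x0; first by rewrite x0 A0 B0.
case: (ltnP x b) => xb; first by rewrite Alow ?Blow // x0.
case: (ltnP x (f - h)) => xh.
  by apply: (ag1 x); [rewrite mem_iota; lia | rewrite inE].
by apply: (ag2 0%N) => //; rewrite mem_iota; lia.
Qed.

Lemma count_id_low (A : bitseq) b c :
  (forall x, (0 < x < b)%N -> nth false A x = false) ->
  (count id (take c A) <= (c - b).+1)%N.
Proof.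
move=> low; rewrite -(cat_take_drop b (take c A)) count_cat.
have h1 : (count id (drop b (take c A)) <= c - b)%N.
  apply: (leq_trans (count_size _ _)); rewrite size_drop size_take.
  by case: ifP; lia.
suff h2 : (count id (take b (take c A)) <= 1)%N by lia.
move: low; case: b {h1} => [|b]; first by rewrite take0.
case: c => [|c] //; case: A => [|a A] //= low.
rewrite (_ : count id _ = 0%N) ?addn0; first by case: a {low}.
apply/eqP; rewrite -leqn0 leqNgt -has_count; apply/negP => /(has_nthP false)[i].
rewrite !size_take => il.
have ib : (i < b)%N by move: il; case: ifP; case: ifP; lia.
have ic : (i < c)%N by move: il; case: ifP; case: ifP; lia.
by rewrite !nth_take //; have /= -> := low i.+1 ib.
Qed.

(** As the genus is [f + 1] minus the number of ones, [f / 4 + 1 - count id A] is its deviation from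
    [3 f / 4]. Replacing it by the deviation of the top bits from their mean costs at most the
    number of free places plus 3. *)
Lemma count_low_free_dev (R : realFieldType) f b (t : R) (P : pred bitseq) :
  (0 < b)%N -> (b <= f - f.-1./2)%N -> 0 <= t ->
  (forall A, size A = f -> P A ->
     [/\ nth false A 0, forall x, (0 < x < b)%N -> nth false A x = false &
         t + (f - f.-1./2 - b)%N%:R + 3 <= `|f%:R / 4 + 1 - (count id A)%:R| ]) ->
  (count P (bits f))%:R * (4 * t ^+ 2)
    <= 2 ^+ (f - f.-1./2 - b) * (f%:R * 2 ^+ f.-1./2).
Proof.
move=> b0 bf t0 hP.
pose h := f.-1./2; pose c := (f - h)%N.
pose Q : pred bitseq := fun w => t <= `|(count id w)%:R - h%:R / 2|.
have hc : (count P (bits f) <= 2 ^ (c - b) * count Q (bits h))%N.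
  apply: count_low_free => // A sA PA.
  have [A0 Alow dev] := hP A sA PA; split=> //; rewrite /Q.
  have c1 : (count id (take c A))%:R <= (c - b)%N%:R + 1 :> R.
    by rewrite natr1 ler_nat count_id_low.
  have h1 : 2 * h%:R <= f%:R :> R by rewrite -natrM ler_nat /h; lia.
  have h2 : f%:R <= 2 * h%:R + 2 :> R by rewrite -natrM -natrD ler_nat /h; lia.
  move: dev; rewrite -[in count id A](cat_take_drop c A) count_cat natrD -/h -/c.
  move: c1 h1 h2.
  have : 0 <= (count id (take c A))%:R :> R by rewrite ler0n.
  move: (count id (take c A))%:R (count id (drop c A))%:R (c - b)%N%:R h%:R f%:R.
  move=> u w d y x u0 ud yx xy dev.
  have -> : w - y / 2 = - ((x / 4 + 1 - (u + w)) - (x / 4 + 1 - y / 2 - u)) by ring.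
  rewrite normrN.
  have : `|x / 4 + 1 - y / 2 - u| <= d + 3 by rewrite ler_norml; apply/andP; split; lra.
  by have := lerB_dist (x / 4 + 1 - (u + w)) (x / 4 + 1 - y / 2 - u); lra.
have ch := @chebyshev_bits R h t Q t0 (fun w _ => id).
have t4 : 0 <= 4 * t ^+ 2 by rewrite mulr_ge0 // sqr_ge0.
apply: (@le_trans _ _ ((2 ^ (c - b) * count Q (bits h))%N%:R * (4 * t ^+ 2))).
  by rewrite ler_wpM2r // ler_nat.
rewrite natrM -mulrA -natrX ler_wpM2l //.
apply: (le_trans ch); rewrite natrM natrX ler_wpM2r ?exprn_ge0 // ler_nat /h; lia.
Qed.

(** Telescoping: 1/(x+2)^2 <= 1/x - 1/(x+2). *)
Lemma sum_inv_sqr (R : realFieldType) f k : (2 * k + 2 < f)%N ->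
  \sum_(m <- iota 1 k) ((f - 2 * m)%N%:R ^+ 2)^-1 <= (f - (2 * k + 2))%N%:R^-1 :> R.
Proof.
elim: k => [|k IHk] kf; first by rewrite big_nil invr_ge0.
rewrite -[X in iota _ X]addn1 iotaD big_cat big_seq1 add1n /=.
have := IHk ltac:(lia); move: (\sum_(_ <- _) _) => S.
have -> : (f - (2 * k + 2) = (f - (2 * k.+1 + 2)) + 2)%N by lia.
have -> : (f - 2 * k.+1 = (f - (2 * k.+1 + 2)) + 2)%N by lia.
have : (0 < f - (2 * k.+1 + 2))%N by lia.
move: (f - _)%N => y; rewrite -(ltr0n R) !natrD; move: y%:R => x x0 hS.
apply: (@le_trans _ _ ((x + 2)^-1 + ((x + 2) ^+ 2)^-1)); first by rewrite lerD2r.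
rewrite -subr_ge0.
have -> : x^-1 - ((x + 2)^-1 + ((x + 2) ^+ 2)^-1) = (x + 4) / (x * (x + 2) ^+ 2).
  by field; rewrite ?andbT; apply/andP; split; apply: lt0r_neq0; lra.
by rewrite divr_ge0 ?mulr_ge0 ?sqr_ge0 //; lra.
Qed.

(** The first term bounds the semigroups of multiplicity below [(f - D)./2], whatever their genus;
    the second bounds the others by Chebyshev's inequality, with at most [D.+3] free places. *)
Lemma count_dev (R : realFieldType) : exists2 C : R, 0 <= C &
  forall f D (t : R) (P : pred bitseq), (0 < D)%N -> (D + 4 <= f)%N -> 0 < t ->
  (forall A, size A = f -> P A ->
     [/\ closed_upto f A, nth false A 0 &
         t + D.+3%:R + 3 <= `|f%:R / 4 + 1 - (count id A)%:R| ]) ->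
  (count P (bits f))%:R
    <= 2 ^+ f.-1./2 * (C / D%:R + 2 ^+ D.+3 * f%:R / (4 * t ^+ 2)).
Proof.
have [C hC] := count_mult_poly; exists C%:R => // f D t P D0 Df t0 hP.
set h := f.-1./2; pose b := (f - D)./2.
pose low k : pred bitseq := fun A => all (fun x => ~~ nth false A x) (iota 1 k.-1).
pose mult m : pred bitseq := fun A => nth false A m && low m A.
have lowP k A : low k A -> forall x, (0 < x < k)%N -> nth false A x = false.
  by move=> /allP lA x xk; apply/negbTE/lA; rewrite mem_iota; lia.
have cov A : P A -> low b A || has (mult^~ A) (iota 1 b.-1).
  move=> _; case lA: (low b A) => //=.
  have [x /andP[xb Ax]] : exists x, (0 < x < b)%N && nth false A x.
    move/negbT/allPn: lA => [x]; rewrite mem_iota negbK => xb Ax.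
    by exists x; rewrite Ax andbT; lia.
  have ex : exists x, (0 < x)%N && nth false A x by exists x; rewrite Ax andbT; lia.
  have [m /andP[m0 Am] minm] := ex_minnP ex.
  apply/hasP; exists m.
    by rewrite mem_iota; have := minm x; rewrite Ax; lia.
  rewrite /mult Am; apply/allP => y; rewrite mem_iota => ym.
  by apply/negP => Ay; have := minm y; rewrite Ay; lia.
have := count_union f cov; rewrite -(ler_nat R) natrD natr_sum => hu.
apply: (le_trans hu); rewrite mulrDr addrC; apply: lerD; last first.
  have hl : (count (predI P (low b)) (bits f))%:R * (4 * t ^+ 2)
      <= 2 ^+ (f - h - b) * (f%:R * 2 ^+ h).
  apply: count_low_free_dev.
  - by rewrite /b; lia.
  - by rewrite /b /h; lia.
  - exact: ltW.
  - move=> A sA /andP[PA /lowP lA]; have [clA A0 dev] := hP A sA PA; split=> //.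
    apply: le_trans dev; rewrite lerD2r lerD2l ler_nat /b /h; lia.
  have t4 : 0 < 4 * t ^+ 2 by rewrite mulr_gt0 // exprn_gt0.
  rewrite [leRHS]mulrA ler_pdivlMr //; apply: (le_trans hl).
  rewrite [leRHS](_ : _ = 2 ^+ D.+3 * (f%:R * 2 ^+ h)); last by ring.
  rewrite ler_wpM2r ?mulr_ge0 ?exprn_ge0 // ler_eXn2l ?ltr1n // /b /h; lia.
apply: (@le_trans _ _ (\sum_(m <- iota 1 b.-1)
   2 ^+ h * C%:R * ((f - 2 * m)%N%:R ^+ 2)^-1)).
  rewrite big_seq [leRHS]big_seq; apply: ler_sum => m; rewrite mem_iota => mb.
  have mf : (2 * m < f)%N by rewrite /b in mb; lia.
  rewrite ler_pdivlMr; last by rewrite exprn_gt0 // ltr0n; lia.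
  have hm : has_mult f m (predI P (mult m)).
    by move=> A sA /and3P[PA Am /lowP lA]; have [clA A0 _] := hP A sA PA.
  have := hC f m _ ltac:(lia) mf hm.
  by rewrite -(ler_nat R) !natrM !natrX [X in _ <= X -> _]mulrC.
rewrite -mulr_sumr -mulrA ler_wpM2l ?exprn_ge0 // ler_wpM2l //.
(* The sum is at most the inverse of [f - 2 * b], which is at least [D]. *)
have bf : (2 * b.-1 + 2 < f)%N by rewrite /b; lia.
apply: (le_trans (sum_inv_sqr R bf)).
rewrite lef_pV2 ?posrE ?ltr0n ?ler_nat /b; lia.
Qed.

(** * Numerical semigroups as bit sequences *)

Local Open Scope classical_set_scope.

Definition semi_bits (f : nat) : pred bitseq :=
  fun A => `[< closed_upto f A /\ nth false A 0 >].

Definition set_of_bits (f : nat) (A : bitseq) : set nat :=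
  [set x | (f < x)%N \/ nth false A x].

Lemma size_fset_set (T : choiceType) (X : set T) (s : seq T) :
  uniq s -> (forall x, X x <-> x \in s) -> #|` fset_set X|%fset = size s.
Proof.
move=> us Xs.
have finX : finite_set X.
  by apply/finite_seqP; exists s; apply/seteqP; split=> x /Xs.
apply/perm_size/uniq_perm => // x.
by rewrite in_fset_set //; apply/idP/idP; rewrite inE => /Xs.
Qed.

Lemma set_of_bits_frobenius f A : size A = f -> semi_bits f A ->
  semigroups_with_frobenius f (set_of_bits f A).
Proof.
move=> sA /asboolP[clA A0]; split; split.
- by right.
- move=> x y [fx|Ax] [fy|Ay]; try by left; lia.
  case: (ltnP f (x + y)) => fxy; [by left | right].
  by have [/eqP ne] := clA x y Ax Ay; apply; lia.
- apply: (@sub_finite_set _ _ `I_f.+1) => // x /= nx.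
  by rewrite ltnS leqNgt; apply/negP => fx; apply: nx; left.
(* Place [f] lies just past the end of [A], so the default value [false] makes it a gap. *)
- by move=> [|]; rewrite ?ltnn // nth_default // sA.
- by move=> x nx; rewrite leqNgt; apply/negP => fx; apply: nx; left.
Qed.

Lemma set_of_bits_inj f :
  {in [pred A : bitseq | size A == f] &, injective (set_of_bits f)}.
Proof.
move=> A B; rewrite !inE => /eqP sA /eqP sB eAB.
apply: (@eq_from_nth _ false); rewrite ?sA ?sB // => x xf.
have hx C : nth false C x <-> set_of_bits f C x.
  by split=> [|[fx|//]]; [right | lia].
by apply/idP/idP => /hx; [rewrite eAB | rewrite -eAB] => /hx.
Qed.

Lemma set_of_bits_surj f S : semigroups_with_frobenius f S ->
  exists2 A, (size A == f) && semi_bits f A & set_of_bits f A = S.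
Proof.
move=> [[S0 SD _] [nSf ubS]].
pose A := mkseq (fun x => `[< S x >]) f.
have AE x : (x < f)%N -> nth false A x = `[< S x >] by move=> xf; rewrite nth_mkseq.
have AS x : nth false A x -> S x.
  case: (ltnP x f) => xf; first by rewrite AE // => /asboolP.
  by rewrite nth_default // size_mkseq.
have f0 : (0 < f)%N by case: (posnP f) => // f0; rewrite f0 in nSf.
exists A; first (apply/andP; split; first by rewrite size_mkseq).
  apply/asboolP; split; last by rewrite AE //; apply/asboolP.
  move=> x y /AS Sx /AS Sy; have Sxy := SD x y Sx Sy; split.
    by apply/eqP => e; apply: nSf; rewrite -e.
  by move=> xyf; rewrite AE //; apply/asboolP.
apply/seteqP; split=> x /=.
  case=> [fx|/AS //]; apply: contrapT => /ubS; lia.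
move=> Sx; case: (ltngtP x f) => xf; [right|by left|].
  by rewrite AE //; apply/asboolP.
by move: nSf; rewrite -xf.
Qed.

Lemma card_semigroups f (X : set (set nat)) : X `<=` semigroups_with_frobenius f ->
  #|` fset_set X|%fset
    = count (fun A => semi_bits f A && `[< X (set_of_bits f A) >]) (bits f).
Proof.
move=> Xf; rewrite -size_filter -(size_map (set_of_bits f)).
apply: size_fset_set.
  rewrite map_inj_in_uniq ?filter_uniq ?uniq_bits // => A B.
  rewrite !mem_filter !mem_bits => /andP[_ sA] /andP[_ sB].
  exact: set_of_bits_inj.
move=> S; split.
  move=> XS; have [A /andP[sA smA] eS] := set_of_bits_surj (Xf S XS).
  apply/mapP; exists A => //; rewrite mem_filter mem_bits sA smA /= andbT.
  by apply/asboolP; rewrite eS.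
by case/mapP => A; rewrite mem_filter => /andP[/andP[_ /asboolP XA] _] ->.
Qed.

(** The gaps are the zeros of [A] and [f] itself, whence the successor. *)
Lemma genus_set_of_bits f A : size A = f ->
  (genus (set_of_bits f A) + count id A = f.+1)%N.
Proof.
move=> sA; pose s := rcons [seq x <- iota 0 f | ~~ nth false A x] f.
have -> : genus (set_of_bits f A) = size s.
  apply: size_fset_set.
    by rewrite rcons_uniq filter_uniq ?iota_uniq // andbT mem_filter mem_iota; lia.
  move=> x; rewrite mem_rcons inE mem_filter mem_iota /=; split.
    move=> nx; case: (ltngtP x f) => // xf; last by exfalso; apply: nx; left.
    by rewrite andbT; apply/negP => Ax; apply: nx; right.
  case/orP => [/eqP ->|/andP[/negP nA xf]].
    by case=> [|Af]; [rewrite ltnn | rewrite nth_default ?sA in Af].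
  by case=> [fx|//]; lia.
rewrite size_rcons size_filter.
have -> : count id A = count (nth false A) (iota 0 f).
  by rewrite -[in LHS](mkseq_nth false A) count_map sA.
by rewrite addSn addnC count_predC size_iota.
Qed.

(** With [h = f.-1./2], adjoin 0 to an arbitrary subset of the top [h] places: two nonzero elements
    add up to at least [2 * (f - h) > f], so closure is automatic. *)
Lemma num_semigroups_ge f : (0 < f)%N -> (2 ^ f.-1./2 <= num_semigroups f)%N.
Proof.
move=> f0; set h := f.-1./2.
rewrite /num_semigroups (card_semigroups (f := f)) // -size_bits -size_filter.
pose up (w : bitseq) := true :: nseq (f - h).-1 false ++ w.
have szup w : size w = h -> size (up w) = f.
  by move=> sw; rewrite /= size_cat size_nseq sw /h; lia.
have nthup w x : (0 < x < f - h)%N -> nth false (up w) x = false.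
  case: x => // x xh; rewrite /up /= nth_cat size_nseq nth_nseq.
  by case: ifP; [case: ifP | lia].
rewrite -(size_map up); apply: uniq_leq_size.
  rewrite map_inj_uniq ?uniq_bits // => v w [].
  by move/eqP; rewrite eqseq_cat // => /andP[_ /eqP].
move=> _ /mapP[w + ->]; rewrite mem_bits => /eqP sw.
have sg : semi_bits f (up w).
  apply/asboolP; split=> // x y ux uy.
  have lt z : nth false (up w) z -> (z < f)%N.
    by move=> uz; rewrite ltnNge; apply/negP => fz; rewrite nth_default ?szup in uz.
  have big z : nth false (up w) z -> z = 0%N \/ (f - h <= z)%N.
    move=> uz; case: (posnP z) => z0; [by left | right].
    by rewrite leqNgt; apply/negP => zh; rewrite nthup ?z0 in uz.
  have := lt x ux; have := lt y uy.
  case: (big x ux) => hx; case: (big y uy) => hy; rewrite ?hx ?hy ?addn0 ?add0n => yf xf.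
  - by split=> //; apply/eqP; lia.
  - by rewrite -hx in xf *; split=> //; apply/eqP; lia.
  - by split=> //; apply/eqP; lia.
  - by split; [apply/eqP; rewrite /h in hx hy; lia | rewrite /h in hx hy; lia].
rewrite mem_filter mem_bits szup // eqxx sg andbT /=.
by apply/asboolP; apply: set_of_bits_frobenius => //; exact: szup.
Qed.

(** * Choice of the parameters and the limit *)

Lemma powR_half_sqr (R : realType) (x eps : R) : 0 < x ->
  (x `^ (1 / 2 + eps)) ^+ 2 = x * x `^ (2 * eps).
Proof.
move=> x0; rewrite -powR_mulrn ?powR_ge0 // -powRrM.
rewrite (_ : (1 / 2 + eps) * 2 = 1 + 2 * eps); last by field.
by rewrite powRD ?powRr1 ?(ltW x0) // (gt_eqF x0) implybT.
Qed.

Lemma dev_small (R : realType) (eps e : R) : 0 < eps -> 0 < e ->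
  exists f0, forall f (P : pred bitseq), (f0 <= f)%N ->
  (forall A, size A = f -> P A ->
     [/\ closed_upto f A, nth false A 0 &
         f%:R `^ (1 / 2 + eps) <= `|f%:R / 4 + 1 - (count id A)%:R| ]) ->
  (count P (bits f))%:R <= e * 2 ^+ f.-1./2.
Proof.
move=> eps0 e0; have [C C0 hC] := count_dev R.
(* [D] depends on [e] only and is fixed before [f] grows, so [2 ^+ D.+3] is a constant. *)
pose D := (Num.truncn (2 * C / e)).+1.
have hD : C / D%:R <= e / 2.
  rewrite ler_pdivrMr ?ltr0n //.
  have /ltW : 2 * C / e < D%:R by rewrite /D truncnS_gt.
  by rewrite ler_pdivrMr // => h; lra.
(* Once [f ^ (2 eps)] exceeds [X], the first summand makes the Chebyshev term at most [e / 2], and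
   the second lets half of the threshold absorb the shift [D.+3 + 3]. *)
pose X : R := 2 ^+ D.+3 * 2 / e + (2 * (D.+3%:R + 3)) ^+ 2.
have X1 : 0 <= 2 ^+ D.+3 * 2 / e :> R.
  by rewrite divr_ge0 ?(ltW e0) // mulr_ge0 // exprn_ge0.
have X2 : 0 < X by apply: ltr_wpDl => //; rewrite exprn_gt0 // mulr_gt0 //; lra.
exists (D + 4 + Num.truncn (X `^ (2 * eps)^-1)).+1 => f P ff hP.
have fX : X <= f%:R `^ (2 * eps).
  have -> : X = (X `^ (2 * eps)^-1) `^ (2 * eps).
    by rewrite -powRrM mulVf ?powRr1 ?(ltW X2) // mulf_neq0 ?gt_eqF.
  apply: ge0_ler_powR; rewrite ?nnegrE ?powR_ge0 ?mulr_ge0 ?(ltW eps0) //.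
  apply: ltW; apply: (lt_le_trans (truncnS_gt _)); rewrite ler_nat.
  by apply: leq_trans ff; rewrite ltnS leq_addl.
have f1 : 1 <= f%:R :> R by rewrite ler1n; exact: leq_ltn_trans ff.
have f0 : 0 < f%:R :> R by lra.
set T := f%:R `^ (1 / 2 + eps) in hP *.
have T0 : 0 < T by exact: powR_gt0.
have T2 : f%:R * X <= T ^+ 2 by rewrite powR_half_sqr // ler_wpM2l.
have T3 : 2 * (D.+3%:R + 3) <= T.
  rewrite -ler_sqr ?nnegrE ?(ltW T0) ?mulr_ge0 //.
  apply: le_trans T2; apply: (@le_trans _ _ X); first by rewrite lerDr.
  by rewrite ler_peMl // ltW.
have h2 : 0 < T / 2 by rewrite divr_gt0.
have Df : (D + 4 <= f)%N by apply: leq_trans ff; exact/leqW/leq_addr.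
apply: (le_trans (hC f D (T / 2) P isT Df h2 _)).
  move=> A sA PA; have [clA A0 dev] := hP A sA PA; split=> //.
  by apply: le_trans dev; move: T3; move: D.+3%:R => d; lra.
rewrite mulrC ler_wpM2r ?exprn_ge0 // [leRHS]splitr; apply: lerD => //.
rewrite ler_pdivrMr ?mulr_gt0 ?exprn_gt0 //.
have -> : 4 * (T / 2) ^+ 2 = T ^+ 2 by field.
apply: (@le_trans _ _ (e / 2 * (f%:R * X))); last by rewrite ler_wpM2l // divr_ge0 ?ltW.
have : 2 ^+ D.+3 * 2 / e <= X by rewrite lerDl sqr_ge0.
rewrite ler_pdivrMr // => h3.
rewrite [leRHS](_ : _ = f%:R * (X * e / 2)); last by field.
rewrite mulrC ler_wpM2l //; move: h3; move: (X) (2 ^+ D.+3) => x y; lra.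
Qed.

Theorem theorem1p3 (R : realType) (eps : R) (eps_gt0 : 0 < eps) :
  (fun f : nat =>
     (#|` fset_set [set S : set nat |
            [/\ numerical_semigroup S,
                is_frobenius_number S f &
                `| (genus S)%:R - 3 * f%:R / 4 | < f%:R `^ (1 / 2 + eps) ] ]
        |%fset)%:R / (num_semigroups f)%:R : R) @ \oo --> (1 : R).
Proof.
apply/cvgrPdist_le => /= e e0.
have [f0 hf0] := dev_small eps_gt0 e0.
near=> f.
have ff0 : (f0 <= f)%N by near: f; exact: nbhs_infty_ge.
have f_gt0 : (0 < f)%N by near: f; exact: nbhs_infty_gt.
set X := [set S : set nat | _].
pose bad : pred bitseq := fun A => semi_bits f A && ~~ `[< X (set_of_bits f A) >].
have hbad : (count bad (bits f))%:R <= e * 2 ^+ f.-1./2.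
  apply: hf0 => // A sA /andP[sgA /asboolPn nX].
  have /asboolP[clA A0] := sgA; split=> //.
  rewrite leNgt; apply/negP => lt_dev; apply: nX.
  have [nS fS] := set_of_bits_frobenius sA sgA; split=> //.
  (* From [g + c = f + 1] the deviation [g - 3 f / 4] equals [f / 4 + 1 - c]. *)
  move: lt_dev; have := genus_set_of_bits sA.
  move: (genus _) (count id A) => g c gc; congr (`|_| < _).
  have : (g + c)%:R = f.+1%:R :> R by rewrite gc.
  by rewrite natrD -natr1 => h; lra.
have Xf : X `<=` semigroups_with_frobenius f by move=> S [].
have split_count : (#|` fset_set X|%fset + count bad (bits f) = num_semigroups f)%N.
  rewrite (card_semigroups Xf) /num_semigroups (card_semigroups (f := f)) //.
  transitivity (count (semi_bits f) (bits f)); last first.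
    apply: eq_in_count => A; rewrite mem_bits => /eqP sA.
    case sg: (semi_bits f A) => //=; apply/esym/asboolP.
    exact: set_of_bits_frobenius.
  elim: (bits f) => //= A s <-; rewrite /bad.
  by case: (semi_bits f A); case: `[< _ >] => /=; lia.
have N_ge : 2 ^+ f.-1./2 <= (num_semigroups f)%:R :> R.
  by rewrite -natrX ler_nat num_semigroups_ge.
have N_gt0 : 0 < (num_semigroups f)%:R :> R.
  by apply: lt_le_trans N_ge; rewrite exprn_gt0.
(* The distance to the limit is the proportion of exceptional semigroups, at most [e] since the
   denominator is at least [2 ^+ f.-1./2]. *)
have -> : 1 - (#|` fset_set X|%fset)%:R / (num_semigroups f)%:R
    = (count bad (bits f))%:R / (num_semigroups f)%:R :> R.
  apply: (mulIf (lt0r_neq0 N_gt0)); rewrite mulrBl !divfK ?lt0r_neq0 // mul1r.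
  by rewrite -split_count natrD addrC addKr.
rewrite ger0_norm ?divr_ge0 // ler_pdivrMr //.
by apply: (le_trans hbad); rewrite ler_wpM2l // ltW.
Unshelve. all: by end_near. Qed.
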